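(* Let $H$ be a Hopf algebra over a field $k$ with bijective antipode $S$, and let $\sigma : H\otimes H\to k$ be a normalized and convolution invertible left 2-cocycle. If $\sigma$ is lazy, then for all $h\in H$: $$\sigma(h_1,S(h_2))=\sigma(S(h_1),h_2),\qquad \sigma(S^{-1}(h_2),h_1)=\sigma(h_2,S^{-1}(h_1)).$$
   Context: Sweedler notation $\Delta(h)=h_1\otimes h_2$ is used. A linear map $\sigma:H\otimes H\to k$ is a left 2-cocycle if $\sigma(a_1,b_1)\sigma(a_2b_2,c)=\sigma(b_1,c_1)\sigma(a,b_2c_2)$ for all $a,b,c\in H$; normalized if $\sigma(1,h)=\sigma(h,1)=\varepsilon(h)$ for all $h$; lazy if $\sigma(h_1,h'_1)h_2h'_2=\sigma(h_2,h'_2)h_1h'_1$ for all $h,h'\in H$. Convolution invertible means invertible in the convolution algebra $\mathrm{Hom}(H\otimes H,k)$. *)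

(* Defs.v *)
From HB Require Import structures.
From mathcomp Require Import all_boot all_algebra.
From mathcomp Require Import boolp.

Set Implicit Arguments.
Unset Strict Implicit.
Unset Printing Implicit Defensive.

Import GRing.Theory.
Local Open Scope ring_scope.
Local Open Scope quotient_scope.

(* The tensor product of two vector spaces: finite formal sums of pairs
   modulo the congruence generated by commutativity and bilinearity.  Scalars
   are absorbed into the factors, and negatives are provided by (- u, v), so
   that formal sums need no coefficients. *)

Section TensorProduct.
Variables (k : fieldType) (U V : lmodType k).

Inductive tensor_eq : seq (U * V) -> seq (U * V) -> Prop :=
| tensor_eq_refl s : tensor_eq s s
| tensor_eq_sym s t : tensor_eq s t -> tensor_eq t s
| tensor_eq_trans s t r : tensor_eq s t -> tensor_eq t r -> tensor_eq s r
| tensor_eq_cat s s' t t' :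
    tensor_eq s s' -> tensor_eq t t' -> tensor_eq (s ++ t) (s' ++ t')
| tensor_eq_catC s t : tensor_eq (s ++ t) (t ++ s)
| tensor_eq_0l v : tensor_eq [:: (0, v)] [::]
| tensor_eq_Dl u u' v : tensor_eq [:: (u + u', v)] [:: (u, v); (u', v)]
| tensor_eq_Dr u v v' : tensor_eq [:: (u, v + v')] [:: (u, v); (u, v')]
| tensor_eq_Z c u v : tensor_eq [:: (c *: u, v)] [:: (u, c *: v)].

Definition tensor_eqb (s t : seq (U * V)) : bool := `[< tensor_eq s t >].

Lemma tensor_eqb_refl : reflexive tensor_eqb.
Proof. by move=> s; apply/asboolP; apply: tensor_eq_refl. Qed.

Lemma tensor_eqb_sym : symmetric tensor_eqb.
Proof.
by move=> s t; apply/asboolP/asboolP; apply: tensor_eq_sym.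
Qed.

Lemma tensor_eqb_trans : transitive tensor_eqb.
Proof.
move=> t s r /asboolP st /asboolP tr; apply/asboolP.
exact: tensor_eq_trans st tr.
Qed.

Canonical tensor_equiv :=
  EquivRel tensor_eqb tensor_eqb_refl tensor_eqb_sym tensor_eqb_trans.

Definition tensor := {eq_quot tensor_eqb}.
HB.instance Definition _ : EqQuotient _ tensor_eqb tensor :=
  EqQuotient.on tensor.
HB.instance Definition _ := Choice.on tensor.

Lemma tensor_piP s t : tensor_eq s t <-> \pi_tensor s = \pi_tensor t.
Proof.
split; first by move=> st; apply/eqmodP/asboolP.
by move=> /eqmodP /asboolP.
Qed.

Lemma tensor_reprP s : tensor_eq (repr (\pi_tensor s)) s.
Proof. by apply/tensor_piP; rewrite reprK. Qed.

Definition tensor_zero : tensor := \pi_tensor [::].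
Definition tensor_add (x y : tensor) : tensor :=
  \pi_tensor (repr x ++ repr y).
Definition tensor_scale (c : k) (x : tensor) : tensor :=
  \pi_tensor [seq (c *: p.1, p.2) | p <- repr x].
Definition tensor_opp : tensor -> tensor := tensor_scale (-1).

Lemma tensor_eq_scale c s t : tensor_eq s t ->
  tensor_eq [seq (c *: p.1, p.2) | p <- s] [seq (c *: p.1, p.2) | p <- t].
Proof.
elim=> {s t} /=.
- by move=> s; apply: tensor_eq_refl.
- by move=> s t _; apply: tensor_eq_sym.
- by move=> s t r _ st _; apply: tensor_eq_trans.
- by move=> s s' t t' _ ss' _ tt'; rewrite !map_cat; apply: tensor_eq_cat.
- by move=> s t; rewrite !map_cat; apply: tensor_eq_catC.
- by move=> v; rewrite scaler0; apply: tensor_eq_0l.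
- by move=> u u' v; rewrite scalerDr; apply: tensor_eq_Dl.
- by move=> u v v'; apply: tensor_eq_Dr.
- by move=> d u v; rewrite scalerA mulrC -scalerA; apply: tensor_eq_Z.
Qed.

Lemma tensor_pi_add s t :
  tensor_add (\pi_tensor s) (\pi_tensor t) = \pi_tensor (s ++ t).
Proof. by apply/tensor_piP; apply: tensor_eq_cat; apply: tensor_reprP. Qed.

Lemma tensor_pi_scale c s :
  tensor_scale c (\pi_tensor s) = \pi_tensor [seq (c *: p.1, p.2) | p <- s].
Proof.
by apply/tensor_piP; apply: tensor_eq_scale; apply: tensor_reprP.
Qed.

Lemma tensor_addA : associative tensor_add.
Proof.
elim/quotW=> s; elim/quotW=> t; elim/quotW=> r.
rewrite (tensor_pi_add s t) (tensor_pi_add t r).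
by rewrite (tensor_pi_add (s ++ t)) (tensor_pi_add s) catA.
Qed.

Lemma tensor_addC : commutative tensor_add.
Proof.
elim/quotW=> s; elim/quotW=> t; rewrite !tensor_pi_add.
by apply/tensor_piP; apply: tensor_eq_catC.
Qed.

Lemma tensor_add0 : left_id tensor_zero tensor_add.
Proof. by elim/quotW=> s; apply: (tensor_pi_add [::] s). Qed.

Lemma tensor_addN : left_inverse tensor_zero tensor_opp tensor_add.
Proof.
elim/quotW=> s; rewrite /tensor_opp (tensor_pi_scale (-1) s).
rewrite (tensor_pi_add _ s) /tensor_zero.
elim: s => [//|[u v] s IHs] /=; apply/tensor_piP; move/tensor_piP: IHs => IHs.
set s' := map _ s in IHs *.
have swap t r : tensor_eq (t ++ (u, v) :: r) ((u, v) :: t ++ r).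
  have := tensor_eq_cat (tensor_eq_catC t [:: (u, v)]) (tensor_eq_refl r).
  by rewrite -!catA.
apply: tensor_eq_trans (swap ((-1 *: u, v) :: s') s) _.
have uN : tensor_eq [:: (u, v); (-1 *: u, v)] [::].
  rewrite scaleN1r; apply: tensor_eq_trans (tensor_eq_sym (tensor_eq_Dl _ _ _)) _.
  by rewrite subrr; apply: tensor_eq_0l.
exact: tensor_eq_cat uN IHs.
Qed.

HB.instance Definition _ := GRing.isZmodule.Build tensor
  tensor_addA tensor_addC tensor_add0 tensor_addN.

Definition tens (u : U) (v : V) : tensor := \pi_tensor [:: (u, v)].

Lemma tensor_piE s : \pi_tensor s = \sum_(p <- s) tens p.1 p.2.
Proof.
elim: s => [|[u v] s IHs]; first by rewrite big_nil.
by rewrite big_cons -IHs -cat1s -tensor_pi_add.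
Qed.

Lemma tensor_reprE (x : tensor) : x = \sum_(p <- repr x) tens p.1 p.2.
Proof. by rewrite -tensor_piE reprK. Qed.

Lemma tensDl u u' v : tens (u + u') v = tens u v + tens u' v.
Proof.
transitivity (\pi_tensor [:: (u, v); (u', v)]).
  exact/tensor_piP/tensor_eq_Dl.
by rewrite tensor_piE 2!big_cons big_nil addr0.
Qed.

Lemma tensDr u v v' : tens u (v + v') = tens u v + tens u v'.
Proof.
transitivity (\pi_tensor [:: (u, v); (u, v')]).
  exact/tensor_piP/tensor_eq_Dr.
by rewrite tensor_piE 2!big_cons big_nil addr0.
Qed.

Lemma tensor_scaleE c s :
  tensor_scale c (\pi_tensor s) = \sum_(p <- s) tens (c *: p.1) p.2.
Proof. by rewrite tensor_pi_scale tensor_piE big_map. Qed.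

Lemma tensor_scaleA c d x :
  tensor_scale c (tensor_scale d x) = tensor_scale (c * d) x.
Proof.
elim/quotW: x => s; rewrite (tensor_pi_scale d s) !(tensor_pi_scale c, tensor_pi_scale (c * d)).
rewrite -map_comp; congr (\pi_tensor _).
by apply: eq_map => p /=; rewrite scalerA.
Qed.

Lemma tensor_scale1 : left_id 1 tensor_scale.
Proof.
elim/quotW=> s; rewrite tensor_scaleE tensor_piE.
by apply: eq_bigr => p _; rewrite scale1r.
Qed.

Lemma tensor_scaleDr : right_distributive tensor_scale +%R.
Proof.
move=> c; elim/quotW=> s; elim/quotW=> t.
by rewrite [_ + _]tensor_pi_add !tensor_scaleE big_cat.
Qed.

Lemma tensor_scaleDl x : {morph tensor_scale^~ x : c d / c + d}.
Proof.
move=> c d; elim/quotW: x => s; rewrite /= !tensor_scaleE -big_split.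
by apply: eq_bigr => p _ /=; rewrite scalerDl tensDl.
Qed.

HB.instance Definition _ := GRing.Zmodule_isLmodule.Build k tensor
  tensor_scaleA tensor_scale1 tensor_scaleDr tensor_scaleDl.

Lemma tensZl c u v : tens (c *: u) v = c *: tens u v.
Proof. by rewrite [RHS]tensor_scaleE big_seq1. Qed.

Lemma tensZr c u v : tens u (c *: v) = c *: tens u v.
Proof. by rewrite -tensZl; apply/esym/tensor_piP/tensor_eq_Z. Qed.

Lemma tens_is_bilinear : bilinear_for *:%R *:%R tens.
Proof.
split=> [v c u u'|u c v v']; first by rewrite /= tensDl tensZl.
by rewrite /= tensDr tensZr.
Qed.

HB.instance Definition _ := bilinear_isBilinear.Build k U V tensor
  *:%R *:%R tens tens_is_bilinear.

(* The value at t of the linear map induced by f, defined for an arbitrary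
   function f: a formal sum representing t is chosen.  As shown by
   tensor_lift_sum, the choice is immaterial as soon as f is bilinear. *)
Definition tensor_lift (W : nmodType) (f : U -> V -> W) (t : tensor) : W :=
  \sum_(p <- repr t) f p.1 p.2.

End TensorProduct.

Notation "U ⊗ V" := (tensor U V) (at level 40, left associativity) : type_scope.
Notation "u ⊗ v" := (tens u v) (at level 40, left associativity) : ring_scope.

(* Sweedler notation: \sw_(h1, h2 <- comul h) E is E(h_1, h_2). *)
Notation "\sw_ ( x , y <- t ) E" := (tensor_lift (fun x y => E) t)
  (at level 36, x name, y name, t at level 10, E at level 36,
   format "\sw_ ( x ,  y  <-  t )  E") : ring_scope.

Section UniversalProperty.
Variables (k : fieldType) (U V W : lmodType k) (f : U -> V -> W).
Hypothesis f_bilin : bilinear_for *:%R *:%R f.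

Let f0l v : f 0 v = 0.
Proof.
by have /= := f_bilin.1 v (-1) 0 0; rewrite scaler0 add0r scaleN1r addNr.
Qed.

Let fDl u u' v : f (u + u') v = f u v + f u' v.
Proof. by have /= := f_bilin.1 v 1 u u'; rewrite !scale1r. Qed.

Let fDr u v v' : f u (v + v') = f u v + f u v'.
Proof. by have /= := f_bilin.2 u 1 v v'; rewrite !scale1r. Qed.

Let fZl c u v : f (c *: u) v = c *: f u v.
Proof. by have /= := f_bilin.1 v c u 0; rewrite f0l !addr0. Qed.

Let f0r u : f u 0 = 0.
Proof.
by have /= := f_bilin.2 u (-1) 0 0; rewrite scaler0 add0r scaleN1r addNr.
Qed.

Let fZr c u v : f u (c *: v) = c *: f u v.
Proof. by have /= := f_bilin.2 u c v 0; rewrite f0r !addr0. Qed.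

Lemma tensor_eq_sum s t : tensor_eq s t ->
  \sum_(p <- s) f p.1 p.2 = \sum_(p <- t) f p.1 p.2.
Proof.
elim=> {s t} //=.
- by move=> s t r _ -> _ ->.
- by move=> s s' t t' _ ss' _ tt'; rewrite !big_cat ss' tt'.
- by move=> s t; rewrite !big_cat /= addrC.
- by move=> v; rewrite big_seq1 big_nil f0l.
- by move=> u u' v; rewrite 3!big_cons !big_nil !addr0 fDl.
- by move=> u v v'; rewrite 3!big_cons !big_nil !addr0 fDr.
- by move=> c u v; rewrite !big_seq1 fZl fZr.
Qed.

Lemma tensor_lift_sum (s : seq (U * V)) :
  tensor_lift f (\sum_(p <- s) p.1 ⊗ p.2) = \sum_(p <- s) f p.1 p.2.
Proof. by rewrite -tensor_piE; apply/tensor_eq_sum/tensor_reprP. Qed.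

Lemma tensor_lift_tens u v : tensor_lift f (u ⊗ v) = f u v.
Proof. by have := tensor_lift_sum [:: (u, v)]; rewrite !big_seq1. Qed.

Lemma tensor_lift_linear : linear (tensor_lift f).
Proof.
move=> c x y; rewrite [in LHS](tensor_reprE x) [in LHS](tensor_reprE y).
rewrite scaler_sumr -[LHS]/(tensor_lift f _).
have -> : \sum_(p <- repr x) c *: (p.1 ⊗ p.2)
       = \sum_(p <- [seq (c *: p.1, p.2) | p <- repr x]) p.1 ⊗ p.2.
  by rewrite big_map; apply: eq_bigr => p _; rewrite tensZl.
rewrite -big_cat tensor_lift_sum big_cat big_map scaler_sumr; congr (_ + _).
by apply: eq_bigr => p _; rewrite fZl.
Qed.

Lemma tensor_lift_unique (g : {linear tensor U V -> W}) :
  (forall u v, g (u ⊗ v) = f u v) -> g =1 tensor_lift f.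
Proof.
move=> gf x; rewrite [in LHS](tensor_reprE x) linear_sum.
by apply: eq_bigr => p _; apply: gf.
Qed.

End UniversalProperty.

HB.mixin Record Lmodule_isCoalgebra (k : fieldType) C of GRing.Lmodule k C := {
  comul : {linear C -> tensor C C};
  counit : {linear C -> k^o};
  (* (C ⊗ C) ⊗ C is identified with C ⊗ (C ⊗ C) *)
  coassoc : forall h : C,
    \sw_(x, z <- comul h) \sw_(x1, x2 <- comul x) (x1 ⊗ (x2 ⊗ z)) =
    \sw_(x, z <- comul h) \sw_(z1, z2 <- comul z) (x ⊗ (z1 ⊗ z2));
  counitl : forall h : C, \sw_(h1, h2 <- comul h) (counit h1 *: h2) = h;
  counitr : forall h : C, \sw_(h1, h2 <- comul h) (counit h2 *: h1) = h
}.

#[short(type="coalgType")]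
HB.structure Definition Coalgebra (k : fieldType) :=
  {C of GRing.Lmodule k C & Lmodule_isCoalgebra k C}.

HB.mixin Record Algebra_Coalgebra_isBialgebra (k : fieldType) B
    of GRing.Algebra k B & Coalgebra k B := {
  comul1 : comul (1 : B) = 1 ⊗ 1;
  comulM : forall a b : B, comul (a * b) =
    \sw_(a1, a2 <- comul a) \sw_(b1, b2 <- comul b) ((a1 * b1) ⊗ (a2 * b2));
  counit1 : counit (1 : B) = 1;
  counitM : forall a b : B, counit (a * b) = counit a * counit b
}.

#[short(type="bialgType")]
HB.structure Definition Bialgebra (k : fieldType) :=
  {B of GRing.Algebra k B & Coalgebra k B & Algebra_Coalgebra_isBialgebra k B}.

HB.mixin Record Bialgebra_isHopfAlgebra (k : fieldType) H of Bialgebra k H := {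
  antipode : {linear H -> H};
  antipodel : forall h : H,
    \sw_(h1, h2 <- comul h) (antipode h1 * h2) = (counit h)%:A;
  antipoder : forall h : H,
    \sw_(h1, h2 <- comul h) (h1 * antipode h2) = (counit h)%:A
}.

#[short(type="hopfAlgType")]
HB.structure Definition HopfAlgebra (k : fieldType) :=
  {H of Bialgebra k H & Bialgebra_isHopfAlgebra k H}.

Section Cocycles.
Variables (k : fieldType) (H : bialgType k).
Implicit Types sigma tau : {linear tensor H H -> k^o}.

Definition left_cocycle sigma := forall a b c : H,
  \sw_(a1, a2 <- comul a) \sw_(b1, b2 <- comul b)
    (sigma (a1 ⊗ b1) * sigma ((a2 * b2) ⊗ c)) =
  \sw_(b1, b2 <- comul b) \sw_(c1, c2 <- comul c)
    (sigma (b1 ⊗ c1) * sigma (a ⊗ (b2 * c2))).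

Definition normalized sigma := forall h : H,
  sigma (1 ⊗ h) = counit h /\ sigma (h ⊗ 1) = counit h.

Definition is_lazy sigma := forall h h' : H,
  \sw_(h1, h2 <- comul h) \sw_(h1', h2' <- comul h')
    (sigma (h1 ⊗ h1') *: (h2 * h2')) =
  \sw_(h1, h2 <- comul h) \sw_(h1', h2' <- comul h')
    (sigma (h2 ⊗ h2') *: (h1 * h1')).

(* The convolution product of Hom(H ⊗ H, k) evaluated at a ⊗ b, where the
   comultiplication of H ⊗ H is a ⊗ b |-> (a_1 ⊗ b_1) ⊗ (a_2 ⊗ b_2) and its
   counit is a ⊗ b |-> counit a * counit b. *)
Definition convolution sigma tau (a b : H) : k :=
  \sw_(a1, a2 <- comul a) \sw_(b1, b2 <- comul b)
    (sigma (a1 ⊗ b1) * tau (a2 ⊗ b2)).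

Definition convolution_invertible sigma :=
  exists tau : {linear tensor H H -> k^o}, forall a b : H,
    convolution sigma tau a b = counit a * counit b /\
    convolution tau sigma a b = counit a * counit b.

End Cocycles.

(* Main.v *)
Require Import Defs.
From HB Require Import structures.
From mathcomp Require Import all_boot all_algebra.
Import GRing.Theory.
Local Open Scope ring_scope.

(** The first identity is the cocycle condition evaluated at the iterated
    coproduct [h_1 ⊗ S(h_2) ⊗ h_3].  As the antipode reverses the coproduct,
    [Δ(S(h)) = S(h_2) ⊗ S(h_1)], the left side of the condition is
    [σ(h_1, S(h_4)) σ(h_2 S(h_3), h_5)]; the antipode axiom collapses
    [h_2 S(h_3)] and normalization then leaves [σ(h_1, S(h_2))].  The right
    side is [σ(S(h_3), h_4) σ(h_1, S(h_2) h_5)], in which the legs that are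
    multiplied are not adjacent, so that nothing cancels.  Laziness lets the
    scalar take the outer legs, [σ(S(h_2), h_5) σ(h_1, S(h_3) h_4)]; now
    [S(h_3) h_4] collapses and normalization leaves [σ(S(h_1), h_2)].

    The second identity is the first one for [S^{-1}(h)]: writing [h = S(g)],
    the coproduct of [h] is [S(g_2) ⊗ S(g_1)], so that its two sides become
    [σ(g_1, S(g_2))] and [σ(S(g_1), g_2)].

    Two facts carry the calculation: [comul_antipode_sw], the reversal of the
    coproduct by the antipode, and [coassoc_sw], coassociativity as an equality
    of iterated Sweedler sums of a trilinear map. *)

(** * Sweedler sums and linearity *)

Set Implicit Arguments.
Unset Strict Implicit.
Unset Printing Implicit Defensive.

Section SweedlerSums.
Variables (k : fieldType) (U V : lmodType k).

Lemma eq_sw (W : nmodType) (f g : U -> V -> W) (t : tensor U V) :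
  (forall u v, f u v = g u v) -> tensor_lift f t = tensor_lift g t.
Proof. by move=> fg; apply: eq_bigr => p _; apply: fg. Qed.

Lemma exchange_sw (U' V' : lmodType k) (W : nmodType)
    (f : U -> V -> U' -> V' -> W) (t : tensor U V) (t' : tensor U' V') :
  \sw_(u, v <- t) \sw_(u', v' <- t') f u v u' v' =
  \sw_(u', v' <- t') \sw_(u, v <- t) f u v u' v'.
Proof. exact: exchange_big. Qed.

Lemma linear_sw (W W' : lmodType k) (G : W -> W') (f : U -> V -> W) t :
  linear G -> G (tensor_lift f t) = \sw_(u, v <- t) G (f u v).
Proof.
move=> GL; pose L := GRing.isLinear.Build _ _ _ _ G GL.
pose g : {linear W -> W'} := HB.pack G L.
exact: (linear_sum g).
Qed.

Lemma sw_tens (W : lmodType k) (f : U -> V -> W) u v :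
  (forall v, linear (fun u => f u v)) -> (forall u, linear (fun v => f u v)) ->
  tensor_lift f (u ⊗ v) = f u v.
Proof. by move=> fl fr; apply: tensor_lift_tens; split. Qed.

End SweedlerSums.

Lemma sw_sw (k : fieldType) (U V U' V' W : lmodType k)
    (f : U' -> V' -> tensor U V) (g : U -> V -> W) t :
  (forall v, linear (fun u => g u v)) -> (forall u, linear (fun v => g u v)) ->
  tensor_lift g (tensor_lift f t) = \sw_(u, v <- t) tensor_lift g (f u v).
Proof.
move=> gl gr; apply: (linear_sw (G := tensor_lift g)).
by apply: tensor_lift_linear; split.
Qed.

(** Every manipulation of a Sweedler sum is licensed by the multilinearity of
    its summand.  The rules below follow the syntax of such summands, and the
    tactic [multilin] applies them recursively. *)
Section LinearityRules.
Variables (k : fieldType).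
Implicit Types U V W : lmodType k.

Lemma lin_id U : linear (fun x : U => x).
Proof. by []. Qed.

Lemma lin_comp U V W (g : {linear V -> W}) (f : U -> V) :
  linear f -> linear (fun x => g (f x)).
Proof. by move=> fL c x y; rewrite fL linearP. Qed.

Lemma lin_comp_fun U V W (g : V -> W) (f : U -> V) :
  linear g -> linear f -> linear (fun x => g (f x)).
Proof. by move=> gL fL c x y; rewrite fL gL. Qed.

Lemma lin_tensl U V W (f : U -> V) (w : W) :
  linear f -> linear (fun x => f x ⊗ w).
Proof. by move=> fL c x y; rewrite fL tensDl tensZl. Qed.

Lemma lin_tensr U V W (f : U -> V) (w : W) :
  linear f -> linear (fun x => w ⊗ f x).
Proof. by move=> fL c x y; rewrite fL tensDr tensZr. Qed.

Lemma lin_mull U (A : algType k) (f : U -> A) (a : A) :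
  linear f -> linear (fun x => f x * a).
Proof. by move=> fL c x y; rewrite fL mulrDl scalerAl. Qed.

Lemma lin_mulr U (A : algType k) (f : U -> A) (a : A) :
  linear f -> linear (fun x => a * f x).
Proof. by move=> fL c x y; rewrite fL mulrDr scalerAr. Qed.

Lemma lin_sw U V V' W (F : U -> V -> V' -> W) (t : tensor V V') :
  (forall a b, linear (fun x => F x a b)) ->
  linear (fun x => tensor_lift (F x) t).
Proof.
move=> FL c x y; rewrite /tensor_lift scaler_sumr -big_split.
by apply: eq_bigr => p _; apply: FL.
Qed.

Lemma lin_lift U V V' W (F : V -> V' -> W) (f : U -> tensor V V') :
  (forall b, linear (fun a => F a b)) -> (forall a, linear (fun b => F a b)) ->
  linear f -> linear (fun x => tensor_lift F (f x)).
Proof.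
by move=> Fl Fr fL c x y; rewrite fL tensor_lift_linear //; split.
Qed.

End LinearityRules.

(** The last two rules serve summands headed by a function that is only assumed
    to be bilinear: the hypothesis is found by unification with the slice of
    that function in the argument where the variable occurs. *)
Ltac multilin :=
  cbv beta;
  lazymatch goal with
  | |- GRing.linear_for _ _ => idtac
  | |- _ => intros
  end;
  cbv beta;
  first [ assumption
        | match goal with H : _ |- _ => exact: H end
        | exact: lin_id
        | apply: lin_tensl; multilin
        | apply: lin_tensr; multilin
        | apply: lin_mull; multilin
        | apply: lin_mulr; multilin
        | apply: lin_sw; multilin
        | apply: lin_lift; multilin
        | apply: lin_comp; multilin
        | match goal with
          | |- GRing.linear_for _ (fun x => ?F (@?f x) ?v) =>
              apply: (@lin_comp_fun _ _ _ _ (fun u => F u v) f); multilin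
          | |- GRing.linear_for _ (fun x => ?F ?v (@?f x)) =>
              apply: (@lin_comp_fun _ _ _ _ (fun u => F v u) f); multilin
          end ].

(** * Sums in coalgebras and Hopf algebras *)

Section CoalgebraSums.
Variables (k : fieldType) (H : coalgType k).

(** The coassociativity axiom is an equation in [H ⊗ (H ⊗ H)]; applying to it
    the linear map induced by a trilinear [F] makes it a rule on sums. *)
Lemma coassoc_sw (W : lmodType k) (F : H -> H -> H -> W) (h : H) :
  (forall y z, linear (fun x => F x y z)) ->
  (forall x z, linear (fun y => F x y z)) ->
  (forall x y, linear (fun z => F x y z)) ->
  \sw_(x, z <- comul h) \sw_(x1, x2 <- comul x) F x1 x2 z =
  \sw_(x, t <- comul h) \sw_(y, z <- comul t) F x y z.
Proof.
move=> F1 F2 F3.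
pose G a (t : tensor H H) := \sw_(b, c <- t) F a b c.
have G1 t : linear (fun a => G a t) by rewrite /G; multilin.
have G2 a : linear (fun t => G a t) by rewrite /G; multilin.
have GE a b c : tensor_lift G (a ⊗ (b ⊗ c)) = F a b c.
  by rewrite sw_tens // /G sw_tens.
have := congr1 (tensor_lift G) (coassoc h).
rewrite !(sw_sw _ _ G1 G2).
under eq_sw do rewrite sw_sw //; under eq_sw do under eq_sw do rewrite GE.
under [X in _ = X -> _]eq_sw do rewrite sw_sw //.
by under [X in _ = X -> _]eq_sw do under eq_sw do rewrite GE.
Qed.

(** The counit has values in the module [k^o]; the cast makes them act as
    scalars of [k], so that lemmas on the scaling of [W] recognize them. *)
Lemma counitl_sw (W : lmodType k) (G : H -> W) (h : H) :
  linear G -> \sw_(x, y <- comul h) ((counit x : k) *: G y) = G h.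
Proof.
move=> GL; rewrite -[in RHS](counitl h) linear_sw //.
by apply: eq_sw => x y; rewrite (scalable_linear GL).
Qed.

Lemma counitr_sw (W : lmodType k) (G : H -> W) (h : H) :
  linear G -> \sw_(x, y <- comul h) ((counit y : k) *: G x) = G h.
Proof.
move=> GL; rewrite -[in RHS](counitr h) linear_sw //.
by apply: eq_sw => x y; rewrite (scalable_linear GL).
Qed.

End CoalgebraSums.

Lemma comulM_sw (k : fieldType) (H : bialgType k) (W : lmodType k)
    (F : H -> H -> W) (a b : H) :
  (forall y, linear (fun x => F x y)) -> (forall x, linear (fun y => F x y)) ->
  \sw_(x, y <- comul (a * b)) F x y =
  \sw_(a1, a2 <- comul a) \sw_(b1, b2 <- comul b) F (a1 * b1) (a2 * b2).
Proof.
move=> F1 F2; rewrite comulM sw_sw //; apply: eq_sw => a1 a2.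
by rewrite sw_sw //; apply: eq_sw => b1 b2; rewrite sw_tens.
Qed.

Section HopfSums.
Variables (k : fieldType) (H : hopfAlgType k).
Local Notation S := (@antipode k H).

Lemma antipodel_sw (W : lmodType k) (G : H -> W) (h : H) :
  linear G -> \sw_(x, y <- comul h) G (S x * y) = (counit h : k) *: G 1.
Proof. by move=> GL; rewrite -(scalable_linear GL) -antipodel linear_sw. Qed.

Lemma antipoder_sw (W : lmodType k) (G : H -> W) (h : H) :
  linear G -> \sw_(x, y <- comul h) G (x * S y) = (counit h : k) *: G 1.
Proof. by move=> GL; rewrite -(scalable_linear GL) -antipoder linear_sw. Qed.

(** The antipode axioms in the shape in which they apply to a sum nested to the
    right, with the cancelling pair [S(h_1) h_2] or [h_1 S(h_2)] at its head. *)
Lemma contractl_sw (W : lmodType k) (F : H -> H -> W) (h : H) :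
  (forall y, linear (fun x => F x y)) -> (forall x, linear (fun y => F x y)) ->
  \sw_(x, t <- comul h) \sw_(y, z <- comul t) F (S x * y) z = F 1 h.
Proof.
move=> F1 F2; rewrite -(@coassoc_sw k H W (fun x y z => F (S x * y) z));
  try multilin.
under eq_sw => x z do rewrite (@antipodel_sw W (fun u => F u z)) //.
by rewrite counitl_sw.
Qed.

Lemma contractr_sw (W : lmodType k) (F : H -> H -> W) (h : H) :
  (forall y, linear (fun x => F x y)) -> (forall x, linear (fun y => F x y)) ->
  \sw_(x, t <- comul h) \sw_(y, z <- comul t) F (x * S y) z = F 1 h.
Proof.
move=> F1 F2; rewrite -(@coassoc_sw k H W (fun x y z => F (x * S y) z));
  try multilin.
under eq_sw => x z do rewrite (@antipoder_sw W (fun u => F u z)) //.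
by rewrite counitl_sw.
Qed.

(** [Δ ∘ S] is a left convolution inverse of [Δ] in [Hom(H, H ⊗ H)], because
    [Δ] is multiplicative; the identity is tested against a bilinear [F]. *)
Lemma comul_antipode_convl (W : lmodType k) (F : H -> H -> W) (h : H) :
  (forall y, linear (fun x => F x y)) -> (forall x, linear (fun y => F x y)) ->
  \sw_(a, t <- comul h) \sw_(x, y <- comul (S a)) \sw_(b, c <- comul t)
    F (x * b) (y * c) = (counit h : k) *: F 1 1.
Proof.
move=> F1 F2.
under eq_sw => a t do rewrite -(comulM_sw (S a) t F1 F2).
rewrite (@antipodel_sw W (fun u => \sw_(x, y <- comul u) F x y)); last multilin.
by rewrite comul1 sw_tens.
Qed.

(** [h |-> S(h_2) ⊗ S(h_1)] is a right convolution inverse of [Δ]: the inner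
    pair of [b_1 S(b_4) ⊗ b_2 S(b_3)] collapses before the outer one. *)
Lemma comul_antipode_convr (W : lmodType k) (F : H -> H -> W) (t : H) :
  (forall y, linear (fun x => F x y)) -> (forall x, linear (fun y => F x y)) ->
  \sw_(b, u <- comul t) \sw_(c, v <- comul u) \sw_(d, e <- comul v)
    F (b * S e) (c * S d) = (counit t : k) *: F 1 1.
Proof.
move=> F1 F2.
under eq_sw => b u.
  rewrite (@contractr_sw W (fun m e => F (b * S e) m)); try multilin.
  over.
by rewrite (@antipoder_sw W (fun u => F u 1)).
Qed.

(** The antipode reverses the coproduct, [Δ(S(h)) = S(h_2) ⊗ S(h_1)]: both sides
    are convolution inverses of [Δ].  The proof is the usual argument that
    a left inverse [f] and a right inverse [g] agree, both being equal to
    [f * Δ * g], which is the intermediate sum below. *)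
Lemma comul_antipode_sw (W : lmodType k) (F : H -> H -> W) (h : H) :
  (forall y, linear (fun x => F x y)) -> (forall x, linear (fun y => F x y)) ->
  \sw_(x, y <- comul (S h)) F x y = \sw_(a, b <- comul h) F (S b) (S a).
Proof.
move=> F1 F2.
transitivity (\sw_(a, t <- comul h) \sw_(b, u <- comul t) \sw_(c, v <- comul u)
   \sw_(x, y <- comul (S a)) \sw_(d, e <- comul v)
     F (x * b * S e) (y * c * S d)).
  rewrite -(@counitr_sw k H W (fun a => \sw_(x, y <- comul (S a)) F x y));
    last multilin.
  apply: eq_sw => a t;
  rewrite (linear_sw (G := fun w => (counit t : k) *: w)); last multilin.
  under [RHS]eq_sw do rewrite exchange_sw.
  rewrite exchange_sw; apply: eq_sw => x y.
  under eq_sw do under eq_sw do under eq_sw do rewrite -!mulrA.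
  rewrite (@comul_antipode_convr W (fun p q => F (x * p) (y * q)));
    try multilin.
  by rewrite !mulr1.
(* Regrouping to the left brings together the factors [f * Δ]. *)
under eq_sw => a t.
  rewrite -(@coassoc_sw k H W (fun b c v =>
     \sw_(x, y <- comul (S a)) \sw_(d, e <- comul v)
       F (x * b * S e) (y * c * S d))); try multilin.
  over.
rewrite -(@coassoc_sw k H W (fun a p v =>
   \sw_(b, c <- comul p) \sw_(x, y <- comul (S a)) \sw_(d, e <- comul v)
     F (x * b * S e) (y * c * S d))); try multilin.
under eq_sw => q v.
  under eq_sw => a p do rewrite exchange_sw.
  rewrite (@comul_antipode_convl W (fun x y =>
    \sw_(d, e <- comul v) F (x * S e) (y * S d))); try multilin.
  over.
rewrite (@counitl_sw k H W (fun v => \sw_(d, e <- comul v) F (1 * S e) (1 * S d)));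
  last multilin.
by apply: eq_sw => d e; rewrite !mul1r.
Qed.

End HopfSums.

(** * Lazy cocycles and the antipode *)

Lemma lazy_sw (k : fieldType) (H : bialgType k)
    (sigma : {linear tensor H H -> k^o}) (W : lmodType k)
    (G : H -> W) (h h' : H) :
  is_lazy sigma -> linear G ->
  \sw_(h1, h2 <- comul h) \sw_(h1', h2' <- comul h')
    (sigma (h1 ⊗ h1') *: G (h2 * h2')) =
  \sw_(h1, h2 <- comul h) \sw_(h1', h2' <- comul h')
    (sigma (h2 ⊗ h2') *: G (h1 * h1')).
Proof.
move=> lazy GL; have := congr1 G (lazy h h').
rewrite !(linear_sw _ _ GL).
under eq_sw do rewrite (linear_sw _ _ GL).
under [X in _ = X -> _]eq_sw do rewrite (linear_sw _ _ GL).
under eq_sw do under eq_sw do rewrite (scalable_linear GL).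
by under [X in _ = X -> _]eq_sw do under eq_sw do rewrite (scalable_linear GL).
Qed.

Section LazyCocycle.
Variables (k : fieldType) (H : hopfAlgType k).
Variable sigma : {linear tensor H H -> k^o}.
Local Notation S := (@antipode k H).

(** The left side of the cocycle condition at [h_1 ⊗ S(h_2) ⊗ h_3] is
    [σ(h_1, S(h_4)) σ(h_2 S(h_3), h_5)], where [h_2 S(h_3)] cancels. *)
Lemma cocycle_lhs_antipode (h : H) : normalized sigma ->
  \sw_(a, t <- comul h) \sw_(y, z <- comul t)
    \sw_(a1, a2 <- comul a) \sw_(b1, b2 <- comul (S y))
      (sigma (a1 ⊗ b1) * sigma ((a2 * b2) ⊗ z) : k^o) =
  \sw_(h1, h2 <- comul h) sigma (h1 ⊗ S h2).
Proof.
move=> norm.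
under eq_sw => a t do rewrite exchange_sw.
rewrite (@coassoc_sw k H k^o (fun a1 a2 t => \sw_(y, z <- comul t)
   \sw_(b1, b2 <- comul (S y)) (sigma (a1 ⊗ b1) * sigma ((a2 * b2) ⊗ z) : k^o)));
     try multilin.
apply: eq_sw => a t.
under eq_sw => a2 u.
  under eq_sw => y z.
    rewrite (@comul_antipode_sw k H k^o
     (fun b1 b2 => sigma (a ⊗ b1) * sigma ((a2 * b2) ⊗ z) : k^o)); try multilin.
    over.
  rewrite (@coassoc_sw k H k^o (fun y1 y2 z =>
    sigma (a ⊗ S y2) * sigma ((a2 * S y1) ⊗ z) : k^o)); try multilin.
  over.
rewrite (@contractr_sw k H k^o (fun m v => \sw_(y2, z <- comul v)
   (sigma (a ⊗ S y2) * sigma (m ⊗ z) : k^o))); try multilin.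
under eq_sw => y z do rewrite (norm z).1 mulrC.
by rewrite (@counitr_sw k H k^o (fun y => sigma (a ⊗ S y))); last multilin.
Qed.

(** The right side of the cocycle condition at [h_1 ⊗ S(h_2) ⊗ h_3] is
    [σ(S(h_3), h_4) σ(h_1, S(h_2) h_5)]; laziness makes it
    [σ(S(h_2), h_5) σ(h_1, S(h_3) h_4)], where [S(h_3) h_4] cancels. *)
Lemma cocycle_rhs_antipode (h : H) : normalized sigma -> is_lazy sigma ->
  \sw_(a, t <- comul h) \sw_(y, z <- comul t)
    \sw_(b1, b2 <- comul (S y)) \sw_(z1, z2 <- comul z)
      (sigma (b1 ⊗ z1) * sigma (a ⊗ (b2 * z2)) : k^o) =
  \sw_(h1, h2 <- comul h) sigma (S h1 ⊗ h2).
Proof.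
move=> norm lazy.
under eq_sw => a t.
  under eq_sw => y z.
    rewrite (@lazy_sw k H sigma k^o (fun u => sigma (a ⊗ u))) //; last multilin.
    rewrite (@comul_antipode_sw k H k^o (fun b1 b2 =>
      \sw_(z1, z2 <- comul z) (sigma (b2 ⊗ z2) *: sigma (a ⊗ (b1 * z1)) : k^o)));
        try multilin.
    over.
  rewrite (@coassoc_sw k H k^o (fun y1 y2 z =>
    \sw_(z1, z2 <- comul z) (sigma (S y1 ⊗ z2) *: sigma (a ⊗ (S y2 * z1)) : k^o)));
      try multilin.
  under eq_sw => y u.
    rewrite (@contractl_sw k H k^o (fun m z =>
      sigma (S y ⊗ z) *: sigma (a ⊗ m) : k^o)); try multilin.
    rewrite (norm a).2 [_ *: _]mulrC.
    over.
  rewrite -(@linear_sw k H H k^o k^o (fun w => (counit a : k) *: w));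
    last multilin.
  over.
by rewrite (@counitl_sw k H k^o (fun t =>
  \sw_(y, z <- comul t) sigma (S y ⊗ z))); last multilin.
Qed.

Lemma lazy_cocycle_antipode (h : H) :
  left_cocycle sigma -> normalized sigma -> is_lazy sigma ->
  \sw_(h1, h2 <- comul h) sigma (h1 ⊗ S h2) =
  \sw_(h1, h2 <- comul h) sigma (S h1 ⊗ h2).
Proof.
move=> cocycle norm lazy.
rewrite -cocycle_lhs_antipode // -cocycle_rhs_antipode //.
by apply: eq_sw => a t; apply: eq_sw => y z; apply: cocycle.
Qed.

End LazyCocycle.

Theorem lemma2p1 (k : fieldType) (H : hopfAlgType k)
    (antipode_inv : H -> H)
    (antipodeK : cancel (@antipode k H) antipode_inv)
    (antipode_invK : cancel antipode_inv (@antipode k H))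
    (sigma : {linear tensor H H -> k^o})
    (sigma_cocycle : left_cocycle sigma)
    (sigma_normalized : normalized sigma)
    (sigma_invertible : convolution_invertible sigma)
    (sigma_lazy : is_lazy sigma) (h : H) :
  \sw_(h1, h2 <- comul h) sigma (h1 ⊗ antipode h2) =
    \sw_(h1, h2 <- comul h) sigma (antipode h1 ⊗ h2)
  /\
  \sw_(h1, h2 <- comul h) sigma (antipode_inv h2 ⊗ h1) =
    \sw_(h1, h2 <- comul h) sigma (h2 ⊗ antipode_inv h1).
Proof.
split; first exact: lazy_cocycle_antipode.
have Sinv_lin : linear antipode_inv.
  move=> c x y; rewrite -{1}[x]antipode_invK -{1}[y]antipode_invK.
  by rewrite -linearP antipodeK.
(* With [h = S(g)] both sums become those of the first identity at [g]. *)
rewrite -[h]antipode_invK; set g := antipode_inv h.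
rewrite (@comul_antipode_sw k H k^o (fun x y => sigma (antipode_inv y ⊗ x)));
  try multilin.
rewrite (@comul_antipode_sw k H k^o (fun x y => sigma (y ⊗ antipode_inv x)));
  try multilin.
under eq_sw do rewrite antipodeK.
under [RHS]eq_sw do rewrite antipodeK.
exact: lazy_cocycle_antipode.
Qed.
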